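(* Let $d\in\mathbb{N}$, let $\rho:\mathrm{Pol}(O_d^+)\to B(\mathbb{C})$ be a unital $^*$-representation, and let $\eta:\mathrm{Pol}(O_d^+)\to\mathbb{C}$ be a $\rho$-$\epsilon$-cocycle. Put $V=(\eta(u_{jk}))_{j,k=1}^d\in M_d(\mathbb{C})$. Then $\eta$ admits a generating functional if and only if $VV^*$ has real entries.
   Context: $\mathrm{Pol}(O_d^+)$ is the universal unital $^*$-algebra generated by selfadjoint elements $u_{jk}=u_{jk}^*$, $1\le j,k\le d$, subject to the relations that $u=(u_{jk})$ is unitary ($uu^*=u^*u=I$). Its character $\epsilon$ is the unital $^*$-homomorphism to $\mathbb{C}$ with $\epsilon(u_{jk})=\delta_{jk}$. A $\rho$-$\epsilon$-cocycle (with values in $\mathbb{C}$) is a linear map $\eta$ with $\eta(ab)=\rho(a)\eta(b)+\eta(a)\epsilon(b)$ for all $a,b$. The cocycle $\eta$ admits a generating functional if there is a linear functional $\psi:\mathrm{Pol}(O_d^+)\to\mathbb{C}$ with $\psi(ab)=\psi(a)\epsilon(b)+\epsilon(a)\psi(b)+\overline{\eta(a^* )}\,\eta(b)$ for all $a,b$. $V^*$ is the conjugate transpose. *)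

(* Defs.v *)
From HB Require Import structures.
From mathcomp Require Import all_boot all_order all_algebra.
From mathcomp Require Import boolp reals.
From mathcomp Require Import complex.

Set Implicit Arguments.
Unset Strict Implicit.
Unset Printing Implicit Defensive.

Import Order.TTheory GRing.Theory Num.Theory.
Local Open Scope ring_scope.
Local Open Scope quotient_scope.

HB.mixin Record Algebra_isStarAlgebra (C : numClosedFieldType) A
    of GRing.Algebra C A := {
  star : A -> A;
  starK : involutive star;
  starD : {morph star : a b / a + b};
  starZ : forall (c : C) a, star (c *: a) = c^* *: star a;
  starM : forall a b, star (a * b) = star b * star a
}.

#[short(type="starAlgType")]
HB.structure Definition StarAlgebra (C : numClosedFieldType) :=
  {A of GRing.Algebra C A & Algebra_isStarAlgebra C A}.

Record star_morphism (C : numClosedFieldType) (A B : starAlgType C)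
    (f : A -> B) : Prop := StarMorphism {
  star_morphism_linear : linear f;
  star_morphism1 : f 1 = 1;
  star_morphismM : {morph f : a b / a * b};
  star_morphism_star : {morph f : a / star a}
}.

HB.instance Definition _ (C : numClosedFieldType) :=
  Algebra_isStarAlgebra.Build C C^o
    (@conjCK C) (@rmorphD _ _ (@Num.conj C)) (@rmorphM _ _ (@Num.conj C))
    (fun a b : C => etrans (rmorphM (@Num.conj C) a b) (mulrC _ _)).

Definition adjmx (C : numClosedFieldType) (A : starAlgType C) (d : nat)
    (v : 'M[A]_d) : 'M[A]_d := \matrix_(j, k) star (v k j).

Definition free_orthogonal (C : numClosedFieldType) (A : starAlgType C)
    (d : nat) (v : 'M[A]_d) : Prop :=
  [/\ forall j k, star (v j k) = v j k,
      v *m adjmx v = 1%:M & adjmx v *m v = 1%:M].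

(* Pol(O_d^+) is the type of formal *-polynomials in the generators, modulo the
   congruence generated by the axioms of unital *-algebras and the relations
   u_jk^* = u_jk, u u^* = 1 and u^* u = 1. *)
Inductive polO_term (C : numClosedFieldType) (d : nat) : Type :=
| TGen of 'I_d & 'I_d
| TCst of C
| TAdd of polO_term C d & polO_term C d
| TMul of polO_term C d & polO_term C d
| TStar of polO_term C d.

Arguments TGen C {d}.
Arguments TCst {C} d.

HB.instance Definition _ C d := gen_eqMixin (polO_term C d).
HB.instance Definition _ C d := gen_choiceMixin (polO_term C d).

Inductive polO_eq (C : numClosedFieldType) (d : nat) :
    polO_term C d -> polO_term C d -> Prop :=
| peq_refl s : polO_eq s s
| peq_sym s t : polO_eq s t -> polO_eq t s
| peq_trans s t r : polO_eq s t -> polO_eq t r -> polO_eq s r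
| peq_add s s' t t' :
    polO_eq s s' -> polO_eq t t' -> polO_eq (TAdd s t) (TAdd s' t')
| peq_mul s s' t t' :
    polO_eq s s' -> polO_eq t t' -> polO_eq (TMul s t) (TMul s' t')
| peq_star s s' : polO_eq s s' -> polO_eq (TStar s) (TStar s')
| peq_addA s t r : polO_eq (TAdd s (TAdd t r)) (TAdd (TAdd s t) r)
| peq_addC s t : polO_eq (TAdd s t) (TAdd t s)
| peq_add0 s : polO_eq (TAdd (TCst d 0) s) s
| peq_addN s : polO_eq (TAdd (TMul (TCst d (-1)) s) s) (TCst d 0)
| peq_mulA s t r : polO_eq (TMul s (TMul t r)) (TMul (TMul s t) r)
| peq_mul1 s : polO_eq (TMul (TCst d 1) s) s
| peq_mulDl s t r : polO_eq (TMul (TAdd s t) r) (TAdd (TMul s r) (TMul t r))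
| peq_mulDr s t r : polO_eq (TMul s (TAdd t r)) (TAdd (TMul s t) (TMul s r))
| peq_cstD (c e : C) : polO_eq (TCst d (c + e)) (TAdd (TCst d c) (TCst d e))
| peq_cstM (c e : C) : polO_eq (TCst d (c * e)) (TMul (TCst d c) (TCst d e))
| peq_cstC (c : C) s : polO_eq (TMul (TCst d c) s) (TMul s (TCst d c))
| peq_starK s : polO_eq (TStar (TStar s)) s
| peq_starD s t : polO_eq (TStar (TAdd s t)) (TAdd (TStar s) (TStar t))
| peq_starM s t : polO_eq (TStar (TMul s t)) (TMul (TStar t) (TStar s))
| peq_starC (c : C) : polO_eq (TStar (TCst d c)) (TCst d c^*)
| peq_selfadjoint j k : polO_eq (TStar (TGen C j k)) (TGen C j k)
| peq_uuV j l : polO_eq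
    (\big[@TAdd C d/TCst d 0]_(k < d) TMul (TGen C j k) (TStar (TGen C l k)))
    (TCst d (j == l)%:R)
| peq_uVu j l : polO_eq
    (\big[@TAdd C d/TCst d 0]_(k < d) TMul (TStar (TGen C k j)) (TGen C k l))
    (TCst d (j == l)%:R).

Fixpoint polO_eval (C : numClosedFieldType) (d : nat) (A : starAlgType C)
    (v : 'M[A]_d) (t : polO_term C d) : A :=
  match t with
  | TGen j k => v j k
  | TCst c => c%:A
  | TAdd s t => polO_eval v s + polO_eval v t
  | TMul s t => polO_eval v s * polO_eval v t
  | TStar s => star (polO_eval v s)
  end.

Lemma star1 (C : numClosedFieldType) (A : starAlgType C) : star (1 : A) = 1.
Proof. by rewrite -[LHS]mulr1 -[X in _ * X]starK -starM mulr1 starK. Qed.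

Lemma polO_eval_eq (C : numClosedFieldType) (d : nat) (A : starAlgType C)
    (v : 'M[A]_d) (s t : polO_term C d) :
  free_orthogonal v -> polO_eq s t -> polO_eval v s = polO_eval v t.
Proof.
have evS I (r : seq I) (F : I -> polO_term C d) :
    polO_eval v (\big[@TAdd C d/TCst d 0]_(i <- r) F i)
    = \sum_(i <- r) polO_eval v (F i).
  by apply: (big_morph (polO_eval v)) => //=; rewrite scale0r.
case=> vS vvV vVv; elim=> //= {s t}.
- by move=> s t r _ -> _ ->.
- by move=> s s' t t' _ -> _ ->.
- by move=> s s' t t' _ -> _ ->.
- by move=> s s' _ ->.
- by move=> s t r; rewrite addrA.
- by move=> s t; rewrite addrC.
- by move=> s; rewrite scale0r add0r.
- by move=> s; rewrite scaleN1r mulN1r addNr scale0r.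
- by move=> s t r; rewrite mulrA.
- by move=> s; rewrite scale1r mul1r.
- by move=> s t r; rewrite mulrDl.
- by move=> s t r; rewrite mulrDr.
- by move=> c e; rewrite scalerDl.
- by move=> c e; rewrite -scalerAl mul1r scalerA.
- by move=> c s; rewrite -scalerAl -scalerAr mul1r mulr1.
- by move=> s; rewrite starK.
- by move=> s t; rewrite starD.
- by move=> s t; rewrite starM.
- by move=> c; rewrite starZ star1.
- move=> j l; rewrite evS /=.
  have /matrixP/(_ j l) := vvV; rewrite !mxE.
  under [X in X = _]eq_bigr do rewrite mxE.
  by move=> ->; case: (j == l); rewrite ?scale1r ?scale0r.
- move=> j l; rewrite evS /=.
  have /matrixP/(_ j l) := vVv; rewrite !mxE.
  under [X in X = _]eq_bigr do rewrite mxE.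
  by move=> ->; case: (j == l); rewrite ?scale1r ?scale0r.
Qed.

Lemma polO_equiv_class (C : numClosedFieldType) (d : nat) :
  equiv_class_of (fun s t : polO_term C d => `[< polO_eq s t >]).
Proof.
split.
- by move=> s; apply/asboolP; exact: peq_refl.
- by move=> s t; apply/asboolP/asboolP; exact: peq_sym.
- move=> t s r /asboolP st /asboolP tr; apply/asboolP; exact: peq_trans st tr.
Qed.

Canonical polO_equiv (C : numClosedFieldType) (d : nat) :=
  EquivRelPack (polO_equiv_class C d).

Definition polO (C : numClosedFieldType) (d : nat) :=
  {eq_quot (polO_equiv C d)}.

HB.instance Definition _ C d := Choice.on (polO C d).

Section PolOStructure.
Context (C : numClosedFieldType) (d : nat).
Implicit Types (s t : polO_term C d) (a b c : polO C d).

Definition polO_class s : polO C d := \pi_(polO C d) s.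

Lemma polO_classP s t : polO_class s = polO_class t <-> polO_eq s t.
Proof.
split=> [/eqmodP/asboolP//|st].
by apply/eqmodP/asboolP.
Qed.

Lemma polO_ind (P : polO C d -> Prop) :
  (forall s, P (polO_class s)) -> forall a, P a.
Proof. by move=> Ps a; rewrite -[a]reprK; exact: Ps. Qed.

Lemma polO_reprP s : polO_eq (repr (polO_class s)) s.
Proof. by apply/polO_classP; rewrite /polO_class reprK. Qed.

Definition polO_add a b := polO_class (TAdd (repr a) (repr b)).
Definition polO_mul a b := polO_class (TMul (repr a) (repr b)).
Definition polO_scale (k : C) a := polO_class (TMul (TCst d k) (repr a)).
Definition polO_opp a := polO_scale (-1) a.
Definition polO_star a := polO_class (TStar (repr a)).

Lemma polO_addE s t :
  polO_add (polO_class s) (polO_class t) = polO_class (TAdd s t).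
Proof. by apply/polO_classP/peq_add; exact: polO_reprP. Qed.

Lemma polO_mulE s t :
  polO_mul (polO_class s) (polO_class t) = polO_class (TMul s t).
Proof. by apply/polO_classP/peq_mul; exact: polO_reprP. Qed.

Lemma polO_scaleE (k : C) s :
  polO_scale k (polO_class s) = polO_class (TMul (TCst d k) s).
Proof. by apply/polO_classP/peq_mul; [exact: peq_refl|exact: polO_reprP]. Qed.

Lemma polO_starE s : polO_star (polO_class s) = polO_class (TStar s).
Proof. by apply/polO_classP/peq_star; exact: polO_reprP. Qed.

Let opE := (polO_addE, polO_mulE, polO_scaleE, polO_starE).

Fact polO_addA : associative polO_add.
Proof.
elim/polO_ind=> s; elim/polO_ind=> t; elim/polO_ind=> r; rewrite !opE.
exact/polO_classP/peq_addA.
Qed.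

Fact polO_addC : commutative polO_add.
Proof.
elim/polO_ind=> s; elim/polO_ind=> t; rewrite !opE.
exact/polO_classP/peq_addC.
Qed.

Fact polO_add0 : left_id (polO_class (TCst d 0)) polO_add.
Proof. by elim/polO_ind=> s; rewrite !opE; exact/polO_classP/peq_add0. Qed.

Fact polO_addN : left_inverse (polO_class (TCst d 0)) polO_opp polO_add.
Proof.
by elim/polO_ind=> s; rewrite /polO_opp !opE; exact/polO_classP/peq_addN.
Qed.

HB.instance Definition _ := GRing.isZmodule.Build (polO C d)
  polO_addA polO_addC polO_add0 polO_addN.

Fact polO_mulA : associative polO_mul.
Proof.
elim/polO_ind=> s; elim/polO_ind=> t; elim/polO_ind=> r; rewrite !opE.
exact/polO_classP/peq_mulA.
Qed.

Fact polO_mul1l : left_id (polO_class (TCst d 1)) polO_mul.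
Proof. by elim/polO_ind=> s; rewrite !opE; exact/polO_classP/peq_mul1. Qed.

Fact polO_mul1r : right_id (polO_class (TCst d 1)) polO_mul.
Proof.
elim/polO_ind=> s; rewrite !opE; apply/polO_classP.
by apply: peq_trans (peq_mul1 s); apply/peq_sym/peq_cstC.
Qed.

Fact polO_mulDl : left_distributive polO_mul polO_add.
Proof.
elim/polO_ind=> s; elim/polO_ind=> t; elim/polO_ind=> r; rewrite !opE.
exact/polO_classP/peq_mulDl.
Qed.

Fact polO_mulDr : right_distributive polO_mul polO_add.
Proof.
elim/polO_ind=> s; elim/polO_ind=> t; elim/polO_ind=> r; rewrite !opE.
exact/polO_classP/peq_mulDr.
Qed.

Lemma free_orthogonal1 : free_orthogonal (1%:M : 'M[C^o]_d).
Proof.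
have adj1 : adjmx (1%:M : 'M[C^o]_d) = 1%:M.
  by apply/matrixP=> j k; rewrite !mxE eq_sym; exact: conjC_nat.
split; rewrite ?adj1 ?mulmx1//.
by move=> j k; rewrite !mxE; exact: conjC_nat.
Qed.

Fact polO_oner_neq0 : polO_class (TCst d 1) != polO_class (TCst d 0).
Proof.
apply/eqP => /polO_classP /(polO_eval_eq free_orthogonal1)/=.
by rewrite scale0r scale1r; apply/eqP; exact: oner_neq0.
Qed.

HB.instance Definition _ := GRing.Zmodule_isNzRing.Build (polO C d)
  polO_mulA polO_mul1l polO_mul1r polO_mulDl polO_mulDr polO_oner_neq0.

Fact polO_scaleA (k l : C) a :
  polO_scale k (polO_scale l a) = polO_scale (k * l) a.
Proof.
elim/polO_ind: a => s; rewrite !opE; apply/polO_classP.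
apply: peq_trans (peq_mulA _ _ _) _.
by apply: peq_mul; [exact/peq_sym/peq_cstM|exact: peq_refl].
Qed.

Fact polO_scale1 : left_id 1 polO_scale.
Proof. by elim/polO_ind=> s; rewrite !opE; exact/polO_classP/peq_mul1. Qed.

Fact polO_scaleDr : right_distributive polO_scale +%R.
Proof.
move=> k; elim/polO_ind=> s; elim/polO_ind=> t.
rewrite /GRing.add/= !opE; exact/polO_classP/peq_mulDr.
Qed.

Fact polO_scaleDl a : {morph polO_scale^~ a : k l / k + l}.
Proof.
elim/polO_ind: a => s k l; rewrite !opE [RHS]polO_addE; apply/polO_classP.
apply: peq_trans (peq_mulDl _ _ _).
by apply: peq_mul; [exact: peq_cstD|exact: peq_refl].
Qed.

HB.instance Definition _ := GRing.Zmodule_isLmodule.Build C (polO C d)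
  polO_scaleA polO_scale1 polO_scaleDr polO_scaleDl.

Fact polO_scaleAl (k : C) a b : k *: (a * b) = (k *: a) * b.
Proof.
elim/polO_ind: a => s; elim/polO_ind: b => t.
rewrite /GRing.scale/= /GRing.mul/= !opE; exact/polO_classP/peq_mulA.
Qed.

HB.instance Definition _ :=
  GRing.Lmodule_isLalgebra.Build C (polO C d) polO_scaleAl.

Fact polO_scaleAr (k : C) a b : k *: (a * b) = a * (k *: b).
Proof.
elim/polO_ind: a => s; elim/polO_ind: b => t.
rewrite /GRing.scale/= /GRing.mul/= !opE; apply/polO_classP.
apply: peq_trans (peq_mulA _ _ _) _.
apply: peq_trans (peq_sym (peq_mulA _ _ _)).
by apply: peq_mul; [exact: peq_cstC|exact: peq_refl].
Qed.

HB.instance Definition _ :=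
  GRing.Lalgebra_isAlgebra.Build C (polO C d) polO_scaleAr.

Fact polO_starK : involutive polO_star.
Proof. by elim/polO_ind=> s; rewrite !opE; exact/polO_classP/peq_starK. Qed.

Fact polO_starD : {morph polO_star : a b / a + b}.
Proof.
elim/polO_ind=> s; elim/polO_ind=> t.
rewrite /GRing.add/= !opE; exact/polO_classP/peq_starD.
Qed.

Fact polO_starM a b : polO_star (a * b) = polO_star b * polO_star a.
Proof.
elim/polO_ind: a => s; elim/polO_ind: b => t.
rewrite /GRing.mul/= !opE; exact/polO_classP/peq_starM.
Qed.

Fact polO_starZ (k : C) a : polO_star (k *: a) = k^* *: polO_star a.
Proof.
elim/polO_ind: a => s; rewrite /GRing.scale/= !opE; apply/polO_classP.
apply: peq_trans (peq_starM _ _) _.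
apply: peq_trans (peq_sym (peq_cstC _ _)).
by apply: peq_mul; [exact: peq_refl|exact: peq_starC].
Qed.

HB.instance Definition _ := Algebra_isStarAlgebra.Build C (polO C d)
  polO_starK polO_starD polO_starZ polO_starM.

Definition polO_gen : 'M[polO C d]_d :=
  \matrix_(j, k) polO_class (TGen C j k).

Lemma polO_class_cst (k : C) : polO_class (TCst d k) = k%:A.
Proof.
rewrite [RHS]polO_scaleE; apply/polO_classP/peq_sym.
by apply: peq_trans (peq_cstC _ _) _; exact: peq_mul1.
Qed.

Lemma polO_gen_orthogonal : free_orthogonal polO_gen.
Proof.
have piS I (r : seq I) (F : I -> polO_term C d) :
    polO_class (\big[@TAdd C d/TCst d 0]_(i <- r) F i)
    = \sum_(i <- r) polO_class (F i).
  by apply: (big_morph polO_class) => // s t; rewrite -polO_addE.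
have starG j k : star (polO_class (TGen C j k)) = polO_class (TGen C j k).
  by rewrite [LHS]polO_starE; exact/polO_classP/peq_selfadjoint.
split.
- by move=> j k; rewrite mxE starG.
- apply/matrixP=> j l; rewrite !mxE.
  have /polO_classP := peq_uuV C j l; rewrite piS polO_class_cst => uuV.
  transitivity ((j == l)%:R%:A : polO C d).
    rewrite -uuV; apply: eq_bigr => k _; rewrite !mxE.
    by rewrite -polO_mulE -polO_starE.
  by case: (j == l); rewrite ?scale1r ?scale0r.
- apply/matrixP=> j l; rewrite !mxE.
  have /polO_classP := peq_uVu C j l; rewrite piS polO_class_cst => uVu.
  transitivity ((j == l)%:R%:A : polO C d).
    rewrite -uVu; apply: eq_bigr => k _; rewrite !mxE.
    by rewrite -polO_mulE -polO_starE.
  by case: (j == l); rewrite ?scale1r ?scale0r.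
Qed.

Definition polO_lift (A : starAlgType C) (v : 'M[A]_d) (a : polO C d) : A :=
  polO_eval v (repr a).

Lemma polO_liftE (A : starAlgType C) (v : 'M[A]_d) s :
  free_orthogonal v -> polO_lift v (polO_class s) = polO_eval v s.
Proof. by move=> vP; apply: polO_eval_eq => //; exact: polO_reprP. Qed.

Lemma polO_lift_gen (A : starAlgType C) (v : 'M[A]_d) j k :
  free_orthogonal v -> polO_lift v (polO_gen j k) = v j k.
Proof. by move=> vP; rewrite mxE polO_liftE. Qed.

Lemma polO_lift_morphism (A : starAlgType C) (v : 'M[A]_d) :
  free_orthogonal v -> star_morphism (polO_lift v).
Proof.
move=> vP; split.
- move=> k; elim/polO_ind=> s; elim/polO_ind=> t.
  have -> : k *: polO_class s + polO_class t
      = polO_class (TAdd (TMul (TCst d k) s) t).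
    by rewrite -polO_addE -polO_scaleE.
  by rewrite !polO_liftE//= -scalerAl mul1r.
- by rewrite [LHS]polO_liftE//= scale1r.
- elim/polO_ind=> s; elim/polO_ind=> t.
  by rewrite [X in polO_lift v X]polO_mulE !polO_liftE.
- elim/polO_ind=> s.
  by rewrite [X in polO_lift v X]polO_starE !polO_liftE.
Qed.

Lemma polO_lift_unique (A : starAlgType C) (f g : polO C d -> A) :
  star_morphism f -> star_morphism g ->
  (forall j k, f (polO_gen j k) = g (polO_gen j k)) -> f =1 g.
Proof.
move=> [fl f1 fM fS] [gl g1 gM gS] fg; elim/polO_ind.
have lin0 (h : polO C d -> A) : linear h -> h 0 = 0.
  by move=> hl; rewrite -[X in h X](addNr 0) -scaleN1r hl scaleN1r addNr.
have linZ (h : polO C d -> A) k a : linear h -> h (k *: a) = k *: h a.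
  by move=> hl; rewrite -[X in h X]addr0 hl lin0 ?addr0.
have linD (h : polO C d -> A) a b : linear h -> h (a + b) = h a + h b.
  by move=> hl; rewrite -[X in h (X + _)]scale1r hl scale1r.
elim=> [j k|k|s IHs t IHt|s IHs t IHt|s IHs].
- by have := fg j k; rewrite mxE.
- by rewrite polO_class_cst !linZ// f1 g1.
- by rewrite -polO_addE [LHS]linD// [RHS]linD// IHs IHt.
- by rewrite -polO_mulE [LHS]fM [RHS]gM IHs IHt.
- by rewrite -polO_starE [LHS]fS [RHS]gS IHs.
Qed.

Definition polO_counit : polO C d -> C := polO_lift (1%:M : 'M[C^o]_d).

End PolOStructure.

Arguments polO_gen : clear implicits.
Arguments polO_counit {C d}.

Lemma polO_counit_gen (C : numClosedFieldType) (d : nat) (j k : 'I_d) :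
  polO_counit (polO_gen C d j k) = (j == k)%:R.
Proof.
by rewrite /polO_counit polO_lift_gen ?mxE//; exact: free_orthogonal1.
Qed.

Lemma polO_counit_morphism (C : numClosedFieldType) (d : nat) :
  star_morphism (polO_counit : polO C d -> C^o).
Proof. exact/polO_lift_morphism/free_orthogonal1. Qed.

(* Unital *-representations on the Hilbert space C, with inner product
   <x, y> = x^* y; every linear operator on C is bounded, so B(C) is
   'End(C^o), and the last field says that rho (star a) is the adjoint of
   rho a. *)
Record star_representation (C : numClosedFieldType) (A : starAlgType C)
    (rho : {linear A -> 'End(C^o)}) : Prop := StarRepresentation {
  star_representation1 : rho 1 = \1%VF;
  star_representationM : forall a b, rho (a * b) = (rho a \o rho b)%VF;
  star_representation_star : forall a (x y : C),
    (rho (star a) x : C)^* * y = x^* * (rho a y : C)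
}.

Definition cocycle (C : numClosedFieldType) (d : nat)
    (rho : {linear polO C d -> 'End(C^o)}) (eta : {scalar polO C d}) : Prop :=
  forall a b, eta (a * b) = (rho a (eta b) : C) + eta a * polO_counit b.

Definition generating_functional (C : numClosedFieldType) (d : nat)
    (eta psi : {scalar polO C d}) : Prop :=
  forall a b, psi (a * b) =
    psi a * polO_counit b + polO_counit a * psi b + (eta (star a))^* * eta b.

(* Main.v *)
Require Import Defs.
From HB Require Import structures.
From mathcomp Require Import all_boot all_order all_algebra.
From mathcomp Require Import reals.
From mathcomp Require Import complex.
From mathcomp Require Import ring.
Import GRing.Theory Num.Theory.
Local Open Scope ring_scope.
Local Open Scope sesquilinear_scope.

(** Write [r a = rho a 1] and [h a = (eta (star a))^*]. A functional [psi] is a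
    generating functional for [eta] exactly when
      [[eps, h, psi], [0, r, eta], [0, 0, eps]]
    is multiplicative, and for hermitian [psi] this is a *-homomorphism into the
    3x3 matrices, with the involution "conjugate and reflect in the
    antidiagonal".
    By the universal property of Pol(O_d^+) it is therefore enough to prescribe
    the matrix [G] of values of [psi] on the generators compatibly with the
    relations. These give [V = - r V^T] and [G + G^T = - conj (V V^t* )]; so the
    hermitian matrix [V V^t*] must be symmetric, hence real, and if it is real
    then [G = - conj (V V^t* ) / 2] satisfies every relation. *)

(** * Matrix algebras with the antidiagonal involution *)

Definition flipmx (C : numClosedFieldType) (n : nat) := 'M[C]_n.+1.

HB.instance Definition _ (C : numClosedFieldType) n :=
  GRing.Algebra.on (flipmx C n).

Local Notation conjmx := (map_mx Num.conj).

Section FlipStar.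
Context (C : numClosedFieldType) (n : nat).
Implicit Types a b : flipmx C n.

(** Conjugate transposition would exchange upper and lower triangular matrices; the reflection in
    the antidiagonal preserves the upper triangular ones. *)
Definition flip_star a : flipmx C n :=
  \matrix_(i, j) (a (rev_ord j) (rev_ord i))^*.

Fact flip_starK : involutive flip_star.
Proof. by move=> a; apply/matrixP => i j; rewrite !mxE !rev_ordK conjCK. Qed.

Fact flip_starD : {morph flip_star : a b / a + b}.
Proof. by move=> a b; apply/matrixP => i j; rewrite !mxE rmorphD. Qed.

Fact flip_starZ (c : C) a : flip_star (c *: a) = c^* *: flip_star a.
Proof. by apply/matrixP => i j; rewrite !mxE rmorphM. Qed.

Fact flip_starM a b : flip_star (a * b) = flip_star b * flip_star a.
Proof.
apply/matrixP => i j; rewrite !mxE rmorph_sum (reindex_inj rev_ord_inj) /=.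
by apply: eq_bigr => k _; rewrite !mxE rmorphM mulrC.
Qed.

HB.instance Definition _ := Algebra_isStarAlgebra.Build C (flipmx C n)
  flip_starK flip_starD flip_starZ flip_starM.

End FlipStar.

(** * Orthogonal matrices over the upper triangular algebra *)

Section Triangular.
Context (C : numClosedFieldType).
Implicit Types e h p r y : C.

Definition tri e h p r y : flipmx C 2 :=
  \matrix_(i, j)
    nth 0 (nth [::] [:: [:: e; h; p]; [:: 0; r; y]; [:: 0; 0; e]] i) j.

Lemma triD e h p r y e' h' p' r' y' :
  tri e h p r y + tri e' h' p' r' y'
  = tri (e + e') (h + h') (p + p') (r + r') (y + y').
Proof.
apply/matrixP => -[[|[|[|//]]] ?] [[|[|[|//]]] ?];
  by rewrite !mxE /= ?addr0.
Qed.

Lemma triM e h p r y e' h' p' r' y' :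
  tri e h p r y * tri e' h' p' r' y'
  = tri (e * e') (e * h' + h * r') (e * p' + h * y' + p * e') (r * r')
        (r * y' + y * e').
Proof.
apply/matrixP => -[[|[|[|//]]] ?] [[|[|[|//]]] ?];
  rewrite !mxE !big_ord_recl big_ord0 !mxE /=; ring.
Qed.

Lemma tri_star e h p r y :
  star (tri e h p r y) = tri e^* y^* p^* r^* h^*.
Proof.
apply/matrixP => -[[|[|[|//]]] ?] [[|[|[|//]]] ?];
  by rewrite !mxE /= ?rmorph0.
Qed.

Lemma tri_scalar (c : C) : c%:A = tri c 0 0 c 0.
Proof.
apply/matrixP => -[[|[|[|//]]] ?] [[|[|[|//]]] ?];
  by rewrite !mxE /= ?mulr1 ?mulr0.
Qed.

Lemma tri_sum I (s : seq I) (e h p r y : I -> C) :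
  \sum_(i <- s) tri (e i) (h i) (p i) (r i) (y i)
  = tri (\sum_(i <- s) e i) (\sum_(i <- s) h i) (\sum_(i <- s) p i)
        (\sum_(i <- s) r i) (\sum_(i <- s) y i).
Proof.
elim: s => [|i s IH]; last by rewrite !big_cons IH triD.
by rewrite !big_nil -tri_scalar scale0r.
Qed.

Variable d : nat.
Implicit Types E H P Q Y : 'M[C]_d.

Definition trimx E H P Q Y : 'M[flipmx C 2]_d :=
  \matrix_(j, k) tri (E j k) (H j k) (P j k) (Q j k) (Y j k).

Lemma trimxM E H P Q Y E' H' P' Q' Y' :
  trimx E H P Q Y *m trimx E' H' P' Q' Y'
  = trimx (E *m E') (E *m H' + H *m Q') (E *m P' + H *m Y' + P *m E')
          (Q *m Q') (Q *m Y' + Y *m E').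
Proof.
apply/matrixP => j l; rewrite !mxE.
under eq_bigr do rewrite !mxE triM.
by rewrite tri_sum !big_split.
Qed.

Lemma trimx1 : trimx 1%:M 0 0 1%:M 0 = 1%:M.
Proof.
apply/matrixP => j l; rewrite !mxE -tri_scalar.
by case: eqP; rewrite ?scale1r ?scale0r.
Qed.

(** The involution exchanges [conjmx Y] with [Y] and fixes the real blocks [P] and [Q], so the
    entries are selfadjoint. The hypotheses then say that the blocks above the diagonal vanish in
    the product with the adjoint. *)
Lemma trimx_orthogonal (P Q Y : 'M[C]_d) :
  conjmx P = P -> P^T = P -> conjmx Q = Q -> Q *m Q^T = 1%:M ->
  Q *m Y^T = - Y -> P + P = - (conjmx Y *m Y^T) ->
  free_orthogonal (trimx 1%:M (conjmx Y) P Q Y).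
Proof.
move=> Pr Ps Qr QQ QY PY; set H := conjmx Y.
have selfadj j k : star (trimx 1%:M H P Q Y j k) = trimx 1%:M H P Q Y j k.
  rewrite !mxE tri_star conjC_nat.
  rewrite -[in RHS]Pr -[in RHS]Qr !mxE; congr (tri _ _ _ _ _).
  exact: conjCK.
have adjE : adjmx (trimx 1%:M H P Q Y) = trimx 1%:M H^T P Q^T Y^T.
  by apply/matrixP => j k; rewrite mxE selfadj !mxE eq_sym -[in LHS]Ps mxE.
(* As [Q] is orthogonal, the relations for [u^* u = 1] amount to those for
   [u u^* = 1]. *)
have Q'Q := mulmx1C QQ.
have QH : Q *m H^T = - H.
  by rewrite /H -{1}Qr map_trmx -map_mxM QY map_mxN.
(* These variants are stated for a general [Z] because both [Y] and its conjugate [H] satisfy the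
   twisting relation. *)
have tw (Z : 'M[C]_d) : Q *m Z^T = - Z -> Q^T *m Z = - Z^T.
  by move=> QZ; rewrite -[Z in LHS]opprK -QZ mulmxN mulmxA Q'Q mul1mx.
have tw' (Z : 'M[C]_d) : Q *m Z^T = - Z -> Z *m Q^T = - Z^T.
  by move=> QZ; rewrite -[LHS]trmxK trmx_mul trmxK QZ linearN /=.
have tw2 (Z : 'M[C]_d) : Q *m Z^T = - Z -> Z^T *m Q = - Z.
  by move=> QZ; rewrite -[LHS]trmxK trmx_mul trmxK tw // linearN /= trmxK.
split=> //; rewrite adjE trimxM !mul1mx !mulmx1 -trimx1 ?QQ ?Q'Q.
  congr trimx; rewrite ?tw' ?QY ?subrr ?addNr //.
  by rewrite addrAC PY addNr.
congr trimx; rewrite ?tw2 ?tw ?subrr ?addNr //.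
(* Substituting [Y = - Q *m Y^T] and absorbing [Q] into [H^T] gives the corner block of the other
   product. *)
have -> : H^T *m Y = H *m Y^T.
  by rewrite -[Y in LHS]opprK -QY mulmxN mulmxA tw2 // mulNmx opprK.
by rewrite addrAC PY addNr.
Qed.

End Triangular.

(** Induction on formal polynomials, transported to the operations of the quotient. *)
Lemma polO_alg_ind (C : numClosedFieldType) (d : nat) (P : polO C d -> Prop) :
  (forall j k, P (polO_gen C d j k)) -> (forall c : C, P c%:A) ->
  (forall a b, P a -> P b -> P (a + b)) ->
  (forall a b, P a -> P b -> P (a * b)) ->
  (forall a, P a -> P (star a)) -> forall a, P a.
Proof.
move=> Pg Pc PD PM PS; elim/polO_ind; elim=> [j k|c|s Ps t Pt|s Ps t Pt|s Ps].
- by have := Pg j k; rewrite mxE.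
- by rewrite polO_class_cst.
- by rewrite -polO_addE; exact: PD.
- by rewrite -polO_mulE; exact: PM.
- by rewrite -polO_starE; exact: PS.
Qed.

(** * The characters and the cocycle on sums and products *)

Section Cocycle.
Context (C : numClosedFieldType) (d : nat).
Context (rho : {linear polO C d -> 'End(C^o)}) (eta : {scalar polO C d}).
Hypotheses (rhoP : star_representation rho) (etaP : cocycle rho eta).
Implicit Types a b : polO C d.

Local Notation u := (polO_gen C d).
Local Notation eps := (@polO_counit C d).

(** A linear operator on the line is multiplication by its value at 1, so [rho] amounts to the
    character [r]. *)
Let r a : C := rho a (1 : C^o).

Lemma polO_gen_star j k : star (u j k) = u j k.
Proof. by have [] := polO_gen_orthogonal C d. Qed.

(** Applying [r], [eta] and [psi] to this relation yields all the necessary conditions on their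
    values at the generators. *)
Lemma polO_gen_row j l : \sum_k u j k * u l k = (j == l)%:R.
Proof.
have [_ /matrixP/(_ j l) + _] := polO_gen_orthogonal C d.
rewrite !mxE => <-; apply: eq_bigr => k _.
by rewrite [adjmx _ _ _]mxE polO_gen_star.
Qed.

Lemma rho_scalarE a (x : C) : (rho a x : C) = r a * x.
Proof.
by rewrite -[x in LHS]mulr1 -[x * 1]/(x *: (1 : C^o)) linearZ mulrC.
Qed.

Lemma rho_char1 : r 1 = 1.
Proof. by rewrite /r (star_representation1 rhoP) id_lfunE. Qed.

Lemma rho_charM a b : r (a * b) = r a * r b.
Proof. by rewrite {1}/r (star_representationM rhoP) comp_lfunE rho_scalarE. Qed.

Lemma rho_charD a b : r (a + b) = r a + r b.
Proof. by rewrite /r linearD add_lfunE. Qed.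

Lemma rho_charZ (c : C) a : r (c *: a) = c * r a.
Proof. by rewrite /r linearZ scale_lfunE. Qed.

Lemma rho_char0 : r 0 = 0.
Proof. by rewrite /r linear0 zero_lfunE. Qed.

Lemma rho_char_sum I (s : seq I) (F : I -> polO C d) :
  r (\sum_(i <- s) F i) = \sum_(i <- s) r (F i).
Proof. exact: (big_morph r rho_charD rho_char0). Qed.

Lemma rho_char_star a : r (star a) = (r a)^*.
Proof.
have := star_representation_star rhoP a 1 1.
by rewrite conjC1 mul1r mulr1 => E; rewrite -[LHS]conjCK; congr (_^*).
Qed.

Lemma etaM a b : eta (a * b) = r a * eta b + eta a * eps b.
Proof. by rewrite etaP rho_scalarE. Qed.

Lemma counit1 : eps 1 = 1.
Proof. exact: (star_morphism1 (polO_counit_morphism C d)). Qed.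

Lemma counitM a b : eps (a * b) = eps a * eps b.
Proof. exact: (star_morphismM (polO_counit_morphism C d)). Qed.

Lemma counit_star a : eps (star a) = (eps a)^*.
Proof. exact: (star_morphism_star (polO_counit_morphism C d)). Qed.

Lemma counit_linear (c : C) a b : eps (c *: a + b) = c * eps a + eps b.
Proof. exact: (star_morphism_linear (polO_counit_morphism C d)). Qed.

Lemma counitD a b : eps (a + b) = eps a + eps b.
Proof. by rewrite -[a in LHS]scale1r counit_linear mul1r. Qed.

Lemma counit_scalar (c : C) : eps c%:A = c.
Proof.
rewrite -polO_class_cst /polO_counit polO_liftE; last exact: free_orthogonal1.
exact: mulr1.
Qed.

Lemma eta1 : eta 1 = 0.
Proof.
apply: (addrI (eta 1)); rewrite addr0 -[in RHS](mulr1 1) etaM rho_char1 counit1.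
by rewrite mul1r mulr1.
Qed.

(** * Values of the character and the cocycle on the generators *)

Let V : 'M[C]_d := \matrix_(j, k) eta (u j k).
Let Q : 'M[C]_d := \matrix_(j, k) r (u j k).

(* Rewriting with [!mxE] would also unfold [u j k]. *)
Lemma eta_mxE j k : V j k = eta (u j k). Proof. by rewrite mxE. Qed.

Lemma rho_mxE j k : Q j k = r (u j k). Proof. by rewrite mxE. Qed.

Lemma cocycle_gen_orthogonal : Q *m Q^T = 1%:M.
Proof.
apply/matrixP => j l; rewrite mxE [RHS]mxE.
under eq_bigr do rewrite [_^T _ _]mxE !rho_mxE -rho_charM.
rewrite -rho_char_sum polO_gen_row.
by case: eqP => _; rewrite ?rho_char1 ?rho_char0.
Qed.

Lemma cocycle_gen_real : conjmx Q = Q.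
Proof.
by apply/matrixP => j k; rewrite mxE rho_mxE -rho_char_star polO_gen_star.
Qed.

Lemma sum_counit_gen (F : 'I_d -> C) l : \sum_k F k * eps (u l k) = F l.
Proof.
rewrite (bigD1 l) //= polO_counit_gen eqxx mulr1 big1 ?addr0 // => k kl.
by rewrite polO_counit_gen eq_sym (negPf kl) mulr0.
Qed.

(** Since [eta] kills scalars, applying it to the row relation gives zero, while the cocycle rule
    gives [Q *m V^T + V]. *)
Lemma cocycle_gen : Q *m V^T = - V.
Proof.
apply/matrixP => j l; rewrite mxE [RHS]mxE eta_mxE.
apply/eqP; rewrite -addr_eq0; apply/eqP.
transitivity (eta (j == l)%:R); last first.
  by case: eqP => _; rewrite ?eta1 ?linear0.
rewrite -polO_gen_row linear_sum /=.
under [RHS]eq_bigr do rewrite etaM.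
rewrite big_split /= (sum_counit_gen (fun k => eta (u j k))).
by congr (_ + _); apply: eq_bigr => k _; rewrite [_^T _ _]mxE rho_mxE eta_mxE.
Qed.

(** * The two implications *)

Lemma conj_mul_trC : conjmx V *m V^T = (V *m V^t*)^T.
Proof. by rewrite trmx_mul map_trmx trmxK. Qed.

Lemma generating_functional_real (psi : {scalar polO C d}) :
  generating_functional eta psi -> V *m V^t* \is a realmx.
Proof.
move=> psiP.
have psi1 : psi 1 = 0.
  apply: (addrI (psi 1)); rewrite addr0 -[in RHS](mulr1 1) psiP counit1 eta1.
  by rewrite !mulr0 addr0 mul1r mulr1.
(* Evaluating [psi] on the row relation gives a right-hand side symmetric in [j] and [l]. *)
have VV j l : \sum_k (V j k)^* * V l k = - (psi (u j l) + psi (u l j)).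
  apply/eqP; rewrite -addr_eq0 addrC; apply/eqP.
  transitivity (psi (j == l)%:R); last first.
    by case: eqP => _; rewrite ?psi1 ?linear0.
  rewrite -polO_gen_row linear_sum /=.
  under [RHS]eq_bigr do rewrite psiP polO_gen_star [X in _ + X + _]mulrC.
  rewrite !big_split /= (sum_counit_gen (fun k => psi (u j k))).
  rewrite (sum_counit_gen (fun k => psi (u l k))).
  by congr (_ + _ + _); apply: eq_bigr => k _; rewrite !eta_mxE.
apply/mxOverP => j l; rewrite CrealE; apply/eqP.
have E i k : (V *m V^t*) i k = \sum_m (V k m)^* * V i m.
  rewrite mxE; apply: eq_bigr => m _.
  by rewrite [map_mx _ _ _ _]mxE [_^T _ _]mxE mulrC.
(* Conjugation exchanges the two indices of a hermitian matrix; the symmetry in [VV] exchanges them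
   back. *)
rewrite E rmorph_sum /=.
under eq_bigr do rewrite rmorphM /= conjCK mulrC.
by rewrite !VV addrC.
Qed.

(** The row relation prescribes only the sum of the value matrix of [psi] and its transpose; [G] is
    the symmetric solution when [V *m V^t*] is real. *)
Let G : 'M[C]_d := - (2^-1 *: (conjmx V *m V^T)).
Let T := trimx C d 1%:M (conjmx V) G Q V.

Lemma trimx_cocycle_orthogonal :
  V *m V^t* \is a realmx -> free_orthogonal T.
Proof.
move=> /mxOverP VVr.
have Wr : conjmx (conjmx V *m V^T) = conjmx V *m V^T.
  rewrite conj_mul_trC; apply/matrixP => j k.
  by rewrite mxE [_^T _ _]mxE; exact/CrealP.
(* A hermitian matrix with real entries is symmetric. *)
have Ws : (conjmx V *m V^T)^T = conjmx V *m V^T.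
  rewrite -{2}Wr map_mxM trmx_mul trmxK map_trmx; congr (_ *m _).
  by apply/matrixP => j k; rewrite !mxE; exact/esym/conjCK.
apply: trimx_orthogonal.
- by rewrite map_mxN map_mxZ Wr fmorphV rmorph_nat.
- by rewrite linearN linearZ /= Ws.
- exact: cocycle_gen_real.
- exact: cocycle_gen_orthogonal.
- exact: cocycle_gen.
- by rewrite -opprD -scalerDl -[X in X + X]mul1r -splitr scale1r.
Qed.

(** The four known entries obey the same sum, product and star rules as [tri]. The corner is left
    existential because it is what will define [psi]. *)
Lemma polO_lift_tri a : free_orthogonal T ->
  exists p, polO_lift T a = tri C (eps a) (eta (star a))^* p (r a) (eta a).
Proof.
move=> TP; have [Ll _ LM LS] := polO_lift_morphism TP.
elim/polO_alg_ind: a => [j k|c|a b [p Ea] [q Eb]|a b [p Ea] [q Eb]|a [p Ea]].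
- exists (G j k); rewrite polO_lift_gen // [LHS]mxE.
  by rewrite polO_counit_gen polO_gen_star -eta_mxE -rho_mxE !mxE.
- exists 0; rewrite -polO_class_cst polO_liftE //= polO_class_cst tri_scalar.
  rewrite counit_scalar rho_charZ rho_char1 mulr1 starZ star1 !linearZ /= eta1.
  by rewrite !mulr0 rmorph0.
- exists (p + q); rewrite -[a in LHS]scale1r Ll scale1r Ea Eb triD.
  by rewrite counitD rho_charD starD !linearD /= rmorphD.
- exists (eps a * q + (eta (star a))^* * eta b + p * eps b).
  rewrite LM Ea Eb triM counitM rho_charM starM !etaM rho_char_star counit_star.
  rewrite rmorphD !rmorphM /= !conjCK [r b * _]mulrC [_ * eps a]mulrC.
  by rewrite [X in tri _ _ X]addrC.
- exists p^*.
  by rewrite LS Ea tri_star conjCK counit_star rho_char_star starK.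
Qed.

Lemma real_generating_functional :
  V *m V^t* \is a realmx ->
  exists psi : {scalar polO C d}, generating_functional eta psi.
Proof.
move=> /trimx_cocycle_orthogonal TP.
have [Ll _ LM _] := polO_lift_morphism TP.
(* For the corner entry, multiplicativity of the lift is the identity defining a generating
   functional. *)
pose f a : C := polO_lift T a ord0 ord_max.
have fl : scalar f by move=> c a b; rewrite /f Ll !mxE.
pose fL := GRing.isLinear.Build C (polO C d) C _ f fl.
pose psi : {scalar polO C d} := HB.pack f fL.
have fE a : polO_lift T a = tri C (eps a) (eta (star a))^* (f a) (r a) (eta a).
  by rewrite /f; have [p ->] := polO_lift_tri a TP; rewrite [in RHS]mxE.
exists psi => a b; rewrite /= {1}/f LM !fE triM mxE /=.
by rewrite addrC addrA.
Qed.

End Cocycle.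

Theorem corollary3p9 (R : realType) (d : nat)
    (rho : {linear polO R[i] d -> 'End(R[i]^o)}) (eta : {scalar polO R[i] d}) :
  star_representation rho -> cocycle rho eta ->
  let V : 'M[R[i]]_d := \matrix_(j, k) eta (polO_gen R[i] d j k) in
  (exists psi : {scalar polO R[i] d}, generating_functional eta psi) <->
  V *m V^t* \is a realmx.
Proof.
move=> rhoP etaP V; split=> [[psi]|].
- exact: (generating_functional_real _ _ rho eta rhoP etaP).
- exact: (real_generating_functional _ _ rho eta rhoP etaP).
Qed.
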